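(* Let $(G,\star,g)$ be a log-Euclidean Lie group equipped with a log-Euclidean metric $g$, let $H$ be a closed connected subgroup of $G$ with quotient Riemannian submersion $\pi:(G,g)\to(G/H,g^Q)$, and let $s:G/H\to G$ be the section $$s([p])=\exp_G\bigl(s_{\mathrm{lin}}(\log_G(p)+\mathfrak h)\bigr),$$ where $s_{\mathrm{lin}}=(\mathrm d_{e_G}\pi|_{\mathfrak m})^{-1}:\mathfrak g/\mathfrak h\to\mathfrak m:=\mathfrak h^\perp$. Let $\sigma:G/H\to G$ be a smooth section of $\pi$. Then $\sigma$ is an isometric embedding of $(G/H,g^Q)$ into $(G,g)$ if and only if there exists $h_0\in H$ such that $\sigma([p])=s([p])\star h_0$ for all $[p]\in G/H$.
   Context: A log-Euclidean Lie group is a smooth manifold $G$ with a diffeomorphism $\log_G:G\to\mathfrak g$ onto a finite-dimensional real vector space $\mathfrak g$ (identified with the Lie algebra $T_{e_G}G$), with inverse $\exp_G$, equipped with the commutative Lie group law $u\star v=\exp_G(\log_G(u)+\log_G(v))$. A log-Euclidean metric is $g=\log_G^*\langle\cdot,\cdot\rangle$ for an inner product $\langle\cdot,\cdot\rangle$ on $\mathfrak g$. $\mathfrak h=\log_G(H)$ is a linear subspace of $\mathfrak g$, $\mathfrak h^\perp$ is its orthogonal complement for $\langle\cdot,\cdot\rangle$, and $\mathrm d_{e_G}\pi:\mathfrak g\to\mathfrak g/\mathfrak h$ is $X\mapsto X+\mathfrak h$ (identifying $T_{[e_G]}(G/H)$ with $\mathfrak g/\mathfrak h$). $g^Q$ is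 the unique Riemannian metric on $G/H$ making $\pi$ a Riemannian submersion. A smooth section is a smooth $\sigma$ with $\pi\circ\sigma=\mathrm{id}_{G/H}$; it is an isometric embedding if it is a smooth embedding with $\sigma^*g=g^Q$. *)

(* Defs.v *)
From HB Require Import structures.
From mathcomp Require Import all_boot all_order all_algebra generic_quotient.
From mathcomp Require Import all_classical all_reals all_analysis.
Set Implicit Arguments.
Unset Strict Implicit.
Unset Printing Implicit Defensive.
Import Order.TTheory GRing.Theory Num.Theory.
Import numFieldNormedType.Exports.
Import VectorInternalTheory.
Local Open Scope classical_set_scope.
Local Open Scope ring_scope.

(* Meaningful for open U. In finite dimension, which is the only case used,
   x |-> 'd f x is C^k iff x |-> 'd f x v is C^k for every vector v. *)
Fixpoint Ck_on (R : realType) (E F : normedModType R) (k : nat) (U : set E)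
    (f : E -> F) : Prop :=
  if k is k'.+1 then
    (forall x, U x -> differentiable f x) /\
    (forall v, Ck_on k' U (fun x => 'd f x v))
  else forall x, U x -> {for x, continuous f}.

Definition smooth_on (R : realType) (E F : normedModType R) (U : set E)
    (f : E -> F) : Prop :=
  forall k, Ck_on k U f.

(* A homeomorphism [cmap], with inverse [cinv], from an open set of M onto an
   open set of R^n; the values of [cmap] outside [cdom] and of [cinv] outside
   the image of [cdom] are irrelevant. *)
Record chart (R : realType) (n : nat) (M : topologicalType) := Chart {
  cdom : set M ;
  cmap : M -> 'rV[R]_n ;
  cinv : 'rV[R]_n -> M ;
  cdom_open : open cdom ;
  cimg_open : open (cmap @` cdom) ;
  cmapK : forall p, cdom p -> cinv (cmap p) = p ;
  cmap_cont : forall p, cdom p -> {for p, continuous cmap} ;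
  cinv_cont : forall x, (cmap @` cdom) x -> {for x, continuous cinv} }.

(* [chart_at p] is a preferred chart around p. It serves only to coordinatize
   the tangent space T_p M as R^n: a tangent vector at p is represented by its
   coordinate vector in the chart [chart_at p]. *)
Record manifold (R : realType) (n : nat) (M : topologicalType) := Manifold {
  atlas : set (chart R n M) ;
  chart_at : M -> chart R n M ;
  chart_at_atlas : forall p, atlas (chart_at p) ;
  chart_at_dom : forall p, cdom (chart_at p) p ;
  atlas_compat : forall c d, atlas c -> atlas d ->
    smooth_on (cmap c @` (cdom c `&` cdom d)) (cmap d \o cinv c) ;
  manifold_hausdorff : hausdorff_space M ;
  manifold_second_countable : @second_countable M }.

Section Manifolds.
Context {R : realType} {m n : nat} {M N : topologicalType}.
Variables (A : manifold R m M) (B : manifold R n N).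

Definition smooth (f : M -> N) : Prop :=
  continuous f /\
  forall c d, atlas A c -> atlas B d ->
    smooth_on (cmap c @` (cdom c `&` f @^-1` cdom d)) (cmap d \o f \o cinv c).

(* The differential d_p f : T_p M -> T_(f p) N. *)
Definition dmap (f : M -> N) (p : M) : 'rV[R]_m -> 'rV[R]_n :=
  'd (cmap (chart_at B (f p)) \o f \o cinv (chart_at A p))
     (cmap (chart_at A p) p).

Definition submersion (f : M -> N) : Prop :=
  smooth f /\ forall p w, exists v, dmap f p v = w.

(* An injective immersion that is a homeomorphism onto its image. *)
Definition smooth_embedding (f : M -> N) : Prop :=
  [/\ smooth f,
      forall p, injective (dmap f p),
      injective f &
      forall U, open U <-> exists2 W, open W & U = f @^-1` W].

End Manifolds.

(* Fields p |-> b_p of functions T_p M * T_p M -> R. *)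
Definition tensor_field (R : realType) (n : nat) (M : topologicalType) :=
  M -> 'rV[R]_n -> 'rV[R]_n -> R.

(* The coefficients in the chart c are the functions
   x |-> g_(c^-1 x) (d(c^-1) v) (d(c^-1) w), where d(c^-1) v is read, like any
   tangent vector, in the preferred chart at c^-1 x. *)
Definition riemannian_metric (R : realType) (n : nat) (M : topologicalType)
    (A : manifold R n M) (g : tensor_field R n M) : Prop :=
  (forall p, exists b : {dot 'rV[R]_n for idfun}, g p = b :> (_ -> _ -> R)) /\
  forall c v w, atlas A c ->
    smooth_on (cmap c @` cdom c)
      (fun x => let dcinv := 'd (cmap (chart_at A (cinv c x)) \o cinv c) x in
                g (cinv c x) (dcinv v) (dcinv w) : R^o).

Section Riemannian.
Context {R : realType} {m n : nat} {M N : topologicalType}.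
Variables (A : manifold R m M) (B : manifold R n N).

Definition pullback (f : M -> N) (g : tensor_field R n N) :
    tensor_field R m M :=
  fun p v w => g (f p) (dmap A B f p v) (dmap A B f p w).

Variables (gM : tensor_field R m M) (gN : tensor_field R n N).

(* v is orthogonal to the vertical space ker (d_p f). *)
Definition horizontal (f : M -> N) (p : M) (v : 'rV[R]_m) : Prop :=
  forall w, dmap A B f p w = 0 -> gM p v w = 0.

Definition riemannian_submersion (f : M -> N) : Prop :=
  submersion A B f /\
  forall p v w, horizontal f p v -> horizontal f p w ->
    gN (f p) (dmap A B f p v) (dmap A B f p w) = gM p v w.

Definition isometric_embedding (f : M -> N) : Prop :=
  smooth_embedding A B f /\ pullback f gN = gM.

End Riemannian.

Lemma rV_hausdorff (R : realType) (n : nat) : hausdorff_space 'rV[R]_n.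
Proof. exact: norm_hausdorff. Qed.

Lemma rV_second_countable (R : realType) (n : nat) :
  @second_countable 'rV[R]_n.
Proof.
pose B (q : 'rV[rat]_n * nat) : set 'rV[R]_n :=
  ball (map_mx ratr q.1 : 'rV[R]_n) (q.2.+1%:R^-1).
exists (range B).
  exact: (card_le_trans (card_image_le _ _) (countableP _)).
split; first by move=> _ [q _ <-]; apply: ball_open; rewrite invr_gt0 ltr0n.
move=> x U /nbhs_ballP[e /= e0 eU].
have [k ke] : exists k, k.+1%:R^-1 < e / 2 :> R.
  have [k kP] := ltr_add_invr (divr_gt0 e0 (ltr0n _ 2)).
  by exists k; rewrite add0r in kP.
have k0 : 0 < k.+1%:R^-1 :> R by rewrite invr_gt0 ltr0n.
have hq (i : 'I_n) : exists q : rat, `|ratr q - x ord0 i| < k.+1%:R^-1.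
  have [|q] := @rat_in_itvoo R (x ord0 i) (x ord0 i + k.+1%:R^-1).
    by rewrite ltrDl.
  rewrite in_itv /= => /andP[q1 q2]; exists q.
  by rewrite ger0_norm ?subr_ge0 ?(ltW q1)// ltrBlDl.
have [q qP] := choice hq.
have xB : B (\row_i q i, k) x.
  split=> // i j; rewrite !mxE (ord1 i); exact: qP.
exists (B (\row_i q i, k)) => /=; first by split=> //; exists (\row_i q i, k).
move=> y yB; apply: eU.
apply: le_ball (ball_triangle (ball_sym xB) yB).
by rewrite [leRHS]splitr lerD// ltW.
Qed.

Section StandardManifold.
Context {R : realType} {n : nat}.

Lemma smooth_on_id (E : normedModType R) (U : set E) (f : E -> E) :
  f =1 id -> smooth_on U f.
Proof.
move=> /funext -> [|k] /=; first by move=> x _; exact: cvg_id.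
split=> [x _|v]; first exact: ex_diff.
have -> : (fun x => 'd id x v) = cst v by apply/funext => x; rewrite diff_val.
elim: k v => [|k IH] v /=; first by move=> x _; exact: cvg_cst.
split=> [x _|w]; first exact: differentiable_cst.
suff -> : (fun x => 'd (cst v) x w) = cst 0 by exact: IH.
by apply/funext => x; rewrite diff_val.
Qed.

Lemma id_img_open : open (id @` [set: 'rV[R]_n]).
Proof. by rewrite image_id; exact: openT. Qed.

Definition id_chart : chart R n 'rV[R]_n :=
  @Chart R n 'rV[R]_n setT id id openT id_img_open
    (fun _ _ => erefl) (fun _ _ => cvg_id) (fun _ _ => cvg_id).

Lemma id_atlas_compat (c d : chart R n 'rV[R]_n) :
  [set id_chart] c -> [set id_chart] d ->
  smooth_on (cmap c @` (cdom c `&` cdom d)) (cmap d \o cinv c).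
Proof. by move=> -> ->; exact: smooth_on_id. Qed.

Definition rV_manifold : manifold R n 'rV[R]_n :=
  @Manifold R n 'rV[R]_n [set id_chart] (fun=> id_chart)
    (fun _ => erefl) (fun _ => I) id_atlas_compat
    (@rV_hausdorff R n) (@rV_second_countable R n).

End StandardManifold.

(* The finite-dimensional vector space g carries the manifold structure of
   R^(dim g) through the linear coordinates v2r : g -> R^(dim g), of inverse
   r2v, so the smoothness of logG and expG is that of their coordinate
   expressions. *)
Record log_euclidean (R : realType) (n : nat) (G : topologicalType)
    (MG : manifold R n G) (g : vectType R) := LogEuclidean {
  logG : G -> g ;
  expG : g -> G ;
  logGK : cancel logG expG ;
  expGK : cancel expG logG ;
  logG_smooth : smooth MG (@rV_manifold R (dim g)) (@v2r R g \o logG) ;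
  expG_smooth : smooth (@rV_manifold R (dim g)) MG (expG \o @r2v R g) }.

Section LogEuclidean.
Context {R : realType} {n : nat} {G : topologicalType} {MG : manifold R n G}
  {g : vectType R}.
Variable L : log_euclidean MG g.

Definition lop (u v : G) : G := expG L (logG L u + logG L v).
Definition lone : G := expG L 0.
Definition linv (u : G) : G := expG L (- logG L u).

Lemma lopA : associative lop.
Proof. by move=> u v w; rewrite /lop !expGK addrA. Qed.

Lemma lopC : commutative lop.
Proof. by move=> u v; rewrite /lop addrC. Qed.

Lemma lop1 : left_id lone lop.
Proof. by move=> u; rewrite /lop expGK add0r logGK. Qed.

Lemma lopV : left_inverse lone linv lop.
Proof. by move=> u; rewrite /lop expGK addNr. Qed.

(* The differential d_p logG : T_p G -> g, with T_X g identified with g. *)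
Definition dlog (p : G) (v : 'rV[R]_n) : g :=
  r2v (dmap MG (@rV_manifold R (dim g)) (@v2r R g \o logG L) p v).

Definition log_euclidean_metric (ip : {dot g for idfun}) : tensor_field R n G :=
  fun p v w => ip (dlog p v) (dlog p w).

Definition subgroup (H : set G) : Prop :=
  [/\ H lone,
      forall u v, H u -> H v -> H (lop u v) &
      forall u, H u -> H (linv u)].

Section Quotient.
Variable H : set G.

Definition coset (p : G) : set G := [set lop p h | h in H].

Definition coset_rel (p q : G) : bool := `[< coset p = coset q >].

Lemma coset_rel_equiv : equiv_class_of coset_rel.
Proof.
split=> [p|p q|q p r]; first exact/asboolP.
  by apply/asboolP/asboolP.
by move=> /asboolP pq; rewrite /coset_rel pq.
Qed.

Definition coset_equiv : equiv_rel G := EquivRelPack coset_rel_equiv.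

(* G/H with the quotient topology. Its smooth structure MQ and its metric gQ
   are not constructed: they are the unique ones for which piG is a Riemannian
   submersion, i.e. [riemannian_submersion MG MQ _ gQ piG]. *)
Definition quotG := quotient_topology {eq_quot coset_equiv}%qT.

Definition piG (p : G) : quotG := (\pi_quotG p)%qT.

Lemma piGP (p q : G) : piG p = piG q <-> coset p = coset q.
Proof.
have piE : piG p = piG q <-> p = q %[mod {eq_quot coset_equiv}]%qT by [].
rewrite piE; split=> [/eqmodP e|e]; first exact: (elimT (asboolP _) e).
by apply/eqmodP; apply: (introT (asboolP _) e).
Qed.

Definition hset : set g := logG L @` H.

(* X + h, an element of g/h represented as a subset of g. *)
Definition lcoset (X : g) : set g := [set X + Y | Y in hset].

Variable ip : {dot g for idfun}.

Definition mset : set g := [set X | forall Y, hset Y -> ip X Y = 0].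

(* The inverse of the restriction to m of X |-> X + h; its values on sets that
   are not cosets of h are irrelevant. *)
Definition s_lin : set g -> g := 'pinv_(fun=> 0) mset lcoset.

Definition section_s (c : quotG) : G :=
  expG L (s_lin (lcoset (logG L (repr c)))).

Lemma section_sE (p : G) :
  section_s (piG p) = expG L (s_lin (lcoset (logG L p))).
Proof.
have lcosetE q : lcoset (logG L q) = logG L @` coset q.
  rewrite /lcoset /hset /coset !image_comp.
  by apply: eq_imagel => h _ /=; rewrite expGK.
have : piG (repr (piG p)) = piG p by exact: reprK.
by move=> /piGP e; rewrite /section_s !lcosetE e.
Qed.

End Quotient.

End LogEuclidean.

(* Main.v *)
(* In logarithmic coordinates, s sends X + h to the component of X in h^perp.
   As sigma is a section, log (sigma (pi p)) has the same h^perp-component as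
   log p. If sigma is isometric, Pythagoras applied to horizontal vectors shows
   that the h-component of log o sigma o pi has zero differential, so it is a
   constant vector, the logarithm of h0. Conversely, if that component is
   constant then the differential of sigma takes horizontal values, on which
   d pi is isometric, and d pi o d sigma = id. *)
From HB Require Import structures.
Require Import Defs.
From mathcomp Require Import all_boot all_order all_algebra.
From mathcomp Require Import all_classical all_reals all_analysis.
Set Implicit Arguments.
Unset Strict Implicit.
Unset Printing Implicit Defensive.
Import Order.TTheory GRing.Theory Num.Theory.
Import numFieldNormedType.Exports.
Import VectorInternalTheory.
Local Open Scope classical_set_scope.
Local Open Scope ring_scope.

(** * Differentials of maps between manifolds, read in charts *)

(** The first-order expansion of [f] at [x] is also one of [h], and differentials are unique. The
    hypothesis is local because chart expressions of a composite agree only near the base point. *)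
Lemma near_eq_diff (R : realType) (E F : normedModType R)
    (f h : E -> F) (x : E) :
  (\forall y \near x, f y = h y) -> differentiable f x ->
  differentiable h x /\ 'd h x = 'd f x :> (E -> F).
Proof.
move=> fh df.
have dh : h \o shift x = cst (h x) + 'd f x +o_ 0 id.
  apply/eqaddoP => e e0.
  have /eqaddoP /(_ e e0) := diff_locally df.
  rewrite (nbhs_singleton fh); move: fh; rewrite (near_shift 0) subr0 => fh.
  by apply: filterS2 fh => y /= + e1; rewrite !fctE/= => <-.
have dE := diff_unique (diff_continuous df) dh.
split=> //; apply/diff_locallyP; rewrite dE.
by split=> //; exact: diff_continuous.
Qed.

Lemma linear_rV_continuous (R : realType) (m n : nat)
  (f : {linear 'rV[R]_m -> 'rV[R]_n}) : continuous f.
Proof.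
have -> : (f : _ -> _) = fun x => \sum_i x ord0 i *: f (delta_mx 0 i).
  apply/funext => x; rewrite {1}(row_sum_delta x) linear_sum.
  by apply: eq_bigr => i _; rewrite linearZ.
apply: (continuous_big (P := xpredT) (@add_continuous _)) => i _.
move=> x; apply: (@cvgZr_tmp _ _ _ (nbhs x) _ (fun y : 'rV_m => y ord0 i)).
exact: (@coord_continuous R 1 m ord0 i x).
Qed.

Section MDiff.
Context {R : realType}.

(* Differentiability in the preferred charts only, which makes it stable under
   composition without transporting charts. *)
Definition mdiff {m n : nat} {M N : topologicalType}
    (A : manifold R m M) (B : manifold R n N) (f : M -> N) (p : M) : Prop :=
  {for p, continuous f} /\
  differentiable (cmap (chart_at B (f p)) \o f \o cinv (chart_at A p))
    (cmap (chart_at A p) p).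

Lemma chart_at_cvg {m : nat} {M : topologicalType} (A : manifold R m M)
    (p : M) :
  cinv (chart_at A p) x @[x --> cmap (chart_at A p) p] --> p.
Proof.
have dp := chart_at_dom A p.
rewrite -[X in _ --> X](cmapK dp); apply: cinv_cont.
by exists p.
Qed.

Lemma smooth_mdiff {m n : nat} {M N : topologicalType}
    (A : manifold R m M) (B : manifold R n N) (f : M -> N) (p : M) :
  smooth A B f -> mdiff A B f p.
Proof.
move=> [cf sf]; split; first exact: cf.
have /= [+ _] := sf _ _ (chart_at_atlas A p) (chart_at_atlas B (f p)) 1%N.
by apply; exists p => //; split; exact: chart_at_dom.
Qed.

Section Comp.
Context {l m n : nat} {L M N : topologicalType}.
Context {A : manifold R l L} {B : manifold R m M} {C : manifold R n N}.
Variables (f : L -> M) (h : M -> N) (p : L).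

(** By continuity [f] sends the points near [p] into the domain of the preferred chart at [f p],
    where the inner [cinv] and [cmap] cancel. *)
Lemma near_chart_comp : {for p, continuous f} ->
  \forall x \near cmap (chart_at A p) p,
    ((cmap (chart_at C (h (f p))) \o h \o cinv (chart_at B (f p))) \o
     (cmap (chart_at B (f p)) \o f \o cinv (chart_at A p))) x =
    (cmap (chart_at C (h (f p))) \o (h \o f) \o cinv (chart_at A p)) x.
Proof.
move=> cf.
have fp : (f \o cinv (chart_at A p)) x @[x --> cmap (chart_at A p) p] --> f p.
  exact: (cvg_comp _ _ (@chart_at_cvg _ _ A p) cf).
have dB : nbhs (f p) (cdom (chart_at B (f p))).
  by apply: open_nbhs_nbhs; split; [exact: cdom_open|exact: chart_at_dom].
have : \forall x \near cmap (chart_at A p) p,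
    cdom (chart_at B (f p)) (f (cinv (chart_at A p) x)) by exact: fp.
by apply: filterS => x dx /=; rewrite cmapK.
Qed.

Lemma mdiff_comp_dmap : mdiff A B f p -> mdiff B C h (f p) ->
  mdiff A C (h \o f) p /\
  dmap A C (h \o f) p = dmap B C h (f p) \o dmap A B f p.
Proof.
move=> [cf df] [ch dh].
have E := near_chart_comp cf.
(* The Euclidean chain rule differentiates the expression of [h] at the value that the expression of
   [f] takes at the base point. *)
have e : cmap (chart_at B (f p)) (f p) =
  (cmap (chart_at B (f p)) \o f \o cinv (chart_at A p)) (cmap (chart_at A p) p).
  by rewrite /= cmapK//; exact: chart_at_dom.
rewrite /mdiff /dmap.
move: E e df dh.
set F := (_ \o f \o _).
set H := (cmap (chart_at C (h (f p))) \o h \o _).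
set HF := (_ \o (h \o f) \o _).
move=> E e df; rewrite e => dh.
have dhf := differentiable_comp df dh.
have [hd hE] := near_eq_diff E dhf.
have hfc : {for p, continuous (h \o f)} := continuous_comp cf ch.
split; first exact (conj hfc hd).
by rewrite hE (diff_comp df dh).
Qed.
End Comp.

Lemma dmap_id {m : nat} {M : topologicalType} (A : manifold R m M) (p : M) :
  dmap A A id p = id.
Proof.
have dp := chart_at_dom A p.
have E : \forall x \near cmap (chart_at A p) p,
    x = (cmap (chart_at A p) \o id \o cinv (chart_at A p)) x.
  have : nbhs (cmap (chart_at A p) p)
      (cmap (chart_at A p) @` cdom (chart_at A p)).
    by apply: open_nbhs_nbhs; split; [exact: cimg_open|exists p].
  by apply: filterS => _ [q dq <-] /=; rewrite cmapK.
have did : differentiable (id : 'rV[R]_m -> _) (cmap (chart_at A p) p).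
  exact: ex_diff.
have [_ hE] := near_eq_diff E did.
by rewrite /dmap hE diff_val.
Qed.
End MDiff.

(** * Subspaces and orthogonal projections *)

(** Take a subspace of maximal dimension inside [S]: adding to it the line of a vector of [S] stays
    inside [S], hence cannot enlarge it. *)
Lemma linear_set_vspace (K : fieldType) (E : vectType K) (S : set E) :
  S 0 -> (forall a x y, S x -> S y -> S (a *: x + y)) ->
  exists V : {vspace E}, forall x, x \in V <-> S x.
Proof.
move=> S0 SL.
pose P d :=
  `[< exists2 V : {vspace E}, (forall x, x \in V -> S x) & \dim V = d >].
have exP : exists d, P d.
  exists (\dim (0%VS : {vspace E})); apply/asboolP; exists 0%VS => // x.
  by rewrite memv0 => /eqP ->.
have leP d : P d -> (d <= dim E)%N.
  by move=> /asboolP[V _ <-]; rewrite -dimvf dimvS// subvf.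
case: (ex_maxnP exP leP) => d /asboolP[V VS Vd] dmax; exists V => x; split.
  exact: VS.
move=> Sx.
have VxS y : y \in (V + <[x]>)%VS -> S y.
  move=> /memv_addP[v vV [_ /vlineP[a ->] ->]]; rewrite addrC.
  by apply: SL => //; exact: VS.
have le : (\dim (V + <[x]>)%VS <= \dim V)%N.
  by rewrite Vd; apply: dmax; apply/asboolP; exists (V + <[x]>)%VS.
have : (V == V + <[x]>)%VS by rewrite eqEdim addvSl.
move=> /eqP ->; apply: (subvP (addvSr _ _)); exact: memv_line.
Qed.

(** The complement [W] is the kernel of the pairing with a basis of [V]. It meets [V] trivially by
    definiteness, and rank-nullity gives [V + W] the full dimension; [P] projects onto [V] along
    [W]. *)
Lemma orthogonal_projection (R : realType) (g : vectType R)
    (ip : {dot g for idfun}) (V : {vspace g}) :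
  exists P : 'End(g), (forall x, P x \in V) /\
    forall x y, y \in V -> ip (x - P x) y = 0.
Proof.
pose f (x : g) : 'rV[R]_(\dim V) := \row_i ip x (vbasis V)`_i.
have flin : linear f.
  by move=> a x y; apply/rowP => i; rewrite !mxE linearPl.
pose F : {linear g -> 'rV[R]_(\dim V)} :=
  HB.pack f (GRing.isLinear.Build _ _ _ _ f flin).
pose W := lker (linfun F).
have WP x y : x \in W -> y \in V -> ip x y = 0.
  rewrite memv_ker lfunE => /eqP/rowP /= fx yV.
  rewrite (coord_vbasis yV) linear_sumr big1// => i _.
  by have := fx i; rewrite !mxE linearZr_LR /= => ->; rewrite mulr0.
have VW0 : (V :&: W = 0)%VS.
  apply/eqP; rewrite -subv0; apply/subvP => x /memv_capP[xV xW].
  rewrite memv0; case: eqVneq => // x0.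
  by have := neq0_dnorm_gt0 (s := ip) _ x0; rewrite (WP _ _ xW xV) ltxx.
have VWT : (V + W = fullv)%VS.
  apply/eqP; rewrite eqEdim subvf dimv_disjoint_sum//.
  rewrite -(limg_ker_dim (linfun F) fullv) capfv addnC leq_add2r.
  by rewrite (leq_trans (dimvS (subvf _)))// dimvf /dim /= mul1n.
exists (daddv_pi V W); split=> [x|x y yV]; first exact: memv_pi.
apply: WP yV.
have xVW : x \in (V + W)%VS by rewrite VWT memvf.
rewrite -{1}(daddv_pi_add VW0 xVW) addrAC subrr add0r; exact: memv_pi.
Qed.

(** * Closed connected subgroups of R^n *)

(* t u is the limit of the elements floor (t / |x_k|) x_k of A. *)
Lemma closed_subgroup_limit_direction (R : realType) (n : nat)
    (A : set 'rV[R]_n) (x_ : nat -> 'rV[R]_n) (u : 'rV[R]_n) :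
  (forall x y, A x -> A y -> A (x - y)) -> closed A ->
  (forall k, [/\ A (x_ k), `|x_ k| < k.+1%:R^-1 & x_ k != 0]) ->
  cluster ((fun k => `|x_ k|^-1 *: x_ k) @ \oo) u ->
  forall t, A (t *: u).
Proof.
move=> AB Acl xP ucl t.
have A0 : A 0.
  by have [a _ _] := xP 0%N; rewrite -(subrr (x_ 0%N)); exact: AB.
have AN x : A x -> A (- x) by move=> ?; rewrite -sub0r; exact: AB.
have AD x y : A x -> A y -> A (x + y).
  by move=> ? /AN ?; rewrite -(opprK y); exact: AB.
have An x m : A x -> A (x *+ m).
  by move=> Ax; elim: m => [|m IH]; rewrite ?mulr0n// mulrS; exact: AD.
have Az x (z : int) : A x -> A (z%:~R *: x).
  move=> Ax; rewrite scaler_int; case: z => m; first exact: An.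
  by rewrite NegzE mulrNz; apply/AN/An.
apply: Acl => B /nbhs_ballP[e /= e0 eB].
(* Half of [e] pays for rounding, at most [|x_ k|], and half for [t] times the distance from [u] to
   the direction of [x_ k]; the [+ 1] below covers [t = 0]. *)
have [M Me] : exists M, M.+1%:R^-1 < e / 2.
  have [M] := ltr_add_invr (divr_gt0 e0 (ltr0n _ 2)).
  by rewrite add0r => ?; exists M.
have t0 : 0 < `|t| + 1 by rewrite ltr_pwDr.
have d0 : 0 < e / 2 / (`|t| + 1) by rewrite !divr_gt0.
have [_ [[k Mk <-] uk]] :=
  ucl [set `|x_ k|^-1 *: x_ k | k in [set k | (M <= k)%N]] _
    (ex_intro2 _ _ M I (fun k Mk => ex_intro2 _ _ k Mk erefl))
    (nbhsx_ballx u _ d0).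
have [Axk xk1 xk0] := xP k.
exists ((Num.floor (t / `|x_ k|))%:~R *: x_ k); split; first exact: Az.
apply: eB; rewrite -ball_normE /ball_ /=.
set z := _%:~R.
have -> : t *: u - z *: x_ k =
    t *: (u - `|x_ k|^-1 *: x_ k) + (t / `|x_ k| - z) *: x_ k.
  by rewrite scalerBr scalerBl scalerA addrA subrK.
apply: le_lt_trans (ler_normD _ _) _; rewrite !normrZ (splitr e); apply: ltrD.
  move: uk; rewrite -ball_normE /ball_ /= => uk.
  apply: (@le_lt_trans _ _ ((`|t| + 1) * `|u - `|x_ k|^-1 *: x_ k|)).
    by rewrite ler_wpM2r// lerDl.
  by rewrite mulrC -ltr_pdivlMr.
apply: (@le_lt_trans _ _ (1 * `|x_ k|)).
  rewrite ler_wpM2r//.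
  have /andP[z1 z2] := floor_itv (t / `|x_ k|).
  rewrite ger0_norm ?subr_ge0// lerBlDl; rewrite intrD in z2; exact: ltW.
rewrite mul1r (lt_trans xk1)// (le_lt_trans _ Me)//.
by rewrite lef_pV2 ?posrE// ler_nat.
Qed.

(* The largest subspace V contained in A is open and closed in A. *)
Lemma closed_connected_subgroup_scale (R : realType) (n : nat)
    (A : set 'rV[R]_n) :
  A 0 -> (forall x y, A x -> A y -> A (x - y)) -> closed A -> connected A ->
  forall t x, A x -> A (t *: x).
Proof.
move=> A0 AB Acl Aco.
have AN x : A x -> A (- x) by move=> ?; rewrite -sub0r; exact: AB.
have AD x y : A x -> A y -> A (x + y).
  by move=> ? /AN ?; rewrite -(opprK y); exact: AB.
have [V VE] : exists V : {vspace 'rV[R]_n},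
    forall x, x \in V <-> forall t, A (t *: x).
  apply: (@linear_set_vspace _ _ [set x | forall t, A (t *: x)]).
    by move=> t /=; rewrite scaler0.
  move=> a x y Ax Ay t /=; rewrite scalerDr scalerA; exact: AD.
(* [Q] is a projection with kernel [V]. Since [V] lies in [A], it maps [A] into itself, so its image
   is the transversal on which [A] is studied. *)
pose Q : 'End('rV[R]_n) := (\1 - projv V)%VF.
have QE x : Q x = x - projv V x by rewrite !lfun_simp.
have Qcont : continuous Q := @linear_rV_continuous R n n Q.
have Q0 x : Q x = 0 -> x \in V.
  by rewrite QE => /subr0_eq ->; exact: memv_proj.
have QV x : x \in V -> Q x = 0 by move=> xV; rewrite QE projv_id// subrr.
have QA x : A x -> A (Q x).
  move=> Ax; rewrite QE; apply: AB => //.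
  by have /VE /(_ 1) := memv_proj V x; rewrite scale1r.
have QQ x : Q (Q x) = Q x.
  by rewrite [Q x]QE linearB /= (QV _ (memv_proj V x)) subr0.
(* A is discrete transversally to V, otherwise a limit direction of small
   elements of A would lie in V. *)
have [e e0 eA] : exists2 e, 0 < e &
    forall x, A x -> Q x = x -> `|x| < e -> x = 0.
  apply: contrapT => noe.
  have /choice[x_ x_P] (k : nat) : exists x,
      [/\ A x, Q x = x, `|x| < k.+1%:R^-1 & x != 0].
    apply: contrapT => nox; apply: noe; exists k.+1%:R^-1.
      by rewrite invr_gt0.
    move=> x Ax Qx xk; apply: contrapT => /eqP x0; apply: nox.
    by exists x.
  (* The unit sphere of the transversal is compact, so the normalized [x_ k] have a cluster point
     there. *)
  pose S := [set x : 'rV[R]_n | `|x| = 1] `&` [set x | projv V x = 0].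
  have Scomp : compact S.
    apply: bounded_closed_compact.
      by exists 1; split => // M M1 x [/= -> _]; exact: ltW.
    apply: closedI.
      apply: (@preimage_closed _ _ (fun x : 'rV[R]_n => `|x|) [set 1]) => //.
      by move=> x _; exact: norm_continuous.
    apply: (@preimage_closed _ _ (projv V) [set 0]) => //.
      by move=> x _; exact: (@linear_rV_continuous R n n (projv V)).
    exact/accessible_closed_set1/hausdorff_accessible/norm_hausdorff.
  have FS : ((fun k => `|x_ k|^-1 *: x_ k) @ \oo) S.
    exists 0%N => // k _; have [_ Qk _ k0] := x_P k; split => /=.
      by rewrite normfZV.
    rewrite linearZ /=; have := QE (x_ k); rewrite Qk => /eqP.
    by rewrite eq_sym subr_eq addrC -subr_eq subrr => /eqP <-; rewrite scaler0.
  have [u [[u1 Pu] ucl]] := Scomp _ _ FS.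
  have uV : u \in V.
    apply/VE; apply: closed_subgroup_limit_direction ucl => // k.
    by have [? _ ? ?] := x_P k; split.
  (* [projv V] both fixes and kills [u], which contradicts its norm being 1. *)
  move: u1; rewrite /= -(projv_id uV) Pu normr0 => /esym/eqP.
  by rewrite oner_eq0.
have AV : [set` V] = A.
  apply: Aco.
  - by exists 0; rewrite /= mem0v.
  (* Openness is where discreteness enters: [Q x] is in [A] and shorter than [e], so it vanishes. *)
  - exists (Q @^-1` ball 0 e).
      by apply: open_comp; [move=> x _; exact: Qcont|exact: ball_open].
    apply/seteqP; split=> x /=.
      move=> xV; rewrite QV//; split; last exact: ballxx.
      by have /VE/(_ 1) := xV; rewrite scale1r.
    move=> [Ax]; rewrite -ball_normE /ball_ /= sub0r normrN => Qxe.
    by apply: Q0; apply: eA => //; exact: QA.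
  - exists (Q @^-1` [set 0]).
      apply: preimage_closed; first by move=> x _; exact: Qcont.
      exact/accessible_closed_set1/hausdorff_accessible/norm_hausdorff.
    apply/seteqP; split=> x /=.
      move=> xV; rewrite QV//; split => //.
      by have /VE/(_ 1) := xV; rewrite scale1r.
    by move=> [Ax]; exact: Q0.
by move=> t x; rewrite -{1}AV /= => /VE; apply.
Qed.

(** * Zero differentials and linear maps on R^n *)

(** Each coordinate, restricted to the line through 0 and [x], is a real function with zero
    derivative; its values at 1 and 0 are compared. *)
Lemma diff0_cst (R : realType) (m n : nat) (F : 'rV[R]_m -> 'rV[R]_n) :
  (forall x, differentiable F x) -> (forall x v, 'd F x v = 0) ->
  forall x y, F x = F y.
Proof.
move=> dF F0.
suff H x : F x = F 0 by move=> x y; rewrite H (H y).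
apply/rowP => j.
pose s (t : R) : 'rV[R]_m := t *: x.
pose c (M : 'rV[R]_n) : R := M ord0 j.
have ds t : differentiable s t by exact: ex_diff.
have dc M : differentiable c M by exact: differentiable_coord.
have dFs t : differentiable (F \o s) t by exact: differentiable_comp.
have dh t : differentiable (c \o (F \o s)) t by exact: differentiable_comp.
have := @is_derive_0_is_cst R (c \o (F \o s)) 1 0.
rewrite /= /s scale1r scale0r; apply => t.
apply: DeriveDef; first exact/diff_derivable.
rewrite deriveE// (diff_comp (dFs t) (dc _)) /=.
by rewrite (diff_comp (ds t) (dF _)) /= F0 linear0.
Qed.

Section LinearDmap.
Context {R : realType} {m n : nat}.
Local Notation rV k := (@rV_manifold R k).

Lemma linear_mdiff_dmap (f : {linear 'rV[R]_m -> 'rV[R]_n}) x :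
  mdiff (rV m) (rV n) f x /\ dmap (rV m) (rV n) f x = f.
Proof.
have cf := @linear_rV_continuous _ _ _ f.
split; last exact: (diff_lin x cf).
split; first exact: cf.
exact: (linear_differentiable x cf).
Qed.

Lemma dmap_cst {k : nat} {M : topologicalType} (A : manifold R k M)
    (a : 'rV[R]_n) p : dmap A (rV n) (cst a) p = 0.
Proof. exact: diff_cst. Qed.

Lemma dmap_lin {k : nat} {M : topologicalType} (A : manifold R k M)
    (T : {linear 'rV[R]_m -> 'rV[R]_n}) (f : M -> 'rV[R]_m) p :
  mdiff A (rV m) f p ->
  dmap A (rV n) (T \o f) p = T \o dmap A (rV m) f p.
Proof.
move=> df; have [dT TE] := linear_mdiff_dmap T (f p).
by have [_ ->] := mdiff_comp_dmap df dT; rewrite TE.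
Qed.
End LinearDmap.

Lemma ip_eq0 (R : realType) (g : vectType R) (ip : {dot g for idfun}) X :
  ip X X = 0 -> X = 0.
Proof.
move=> X0; case: (eqVneq X 0) => // /(neq0_dnorm_gt0 (s := ip)).
by rewrite X0 ltxx.
Qed.

(** * Cosets and the subgroup in logarithmic coordinates *)

Section LogEuclideanSubspace.
Context {R : realType} {n : nat} {G : topologicalType} {MG : manifold R n G}
  {g : vectType R}.
Variables (L : log_euclidean MG g) (ip : {dot g for idfun}) (H : set G).
Hypothesis H_subgroup : subgroup L H.

Lemma piG_logP (p q : G) :
  piG L H p = piG L H q <-> hset L H (logG L p - logG L q).
Proof.
have [H1 HM HV] := H_subgroup.
rewrite piGP; split=> [e|[h Hh hE]].
  have : coset L H q p.
    by rewrite -e; exists (lone L) => //; rewrite lopC lop1.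
  by move=> [h Hh <-]; exists h => //; rewrite /lop expGK addrAC subrr add0r.
have -> : p = lop L q h by rewrite /lop hE addrC subrK logGK.
apply/seteqP; split=> _ [k Hk <-].
  by exists (lop L h k); [exact: HM|rewrite lopA].
(* The witness comes from q k = (q h)(h^-1 k). *)
exists (lop L (linv L h) k); first by apply: HM => //; exact: HV.
by rewrite lopA -(lopA L q) (lopC L h) lopV (lopC L q) lop1.
Qed.

(** In linear coordinates [H] becomes a closed connected additive subgroup of R^(dim g), hence
    stable under scaling. *)
Lemma hset_linear : closed H -> connected H ->
  exists V : {vspace g}, forall X, X \in V <-> hset L H X.
Proof.
move=> Hcl Hco; have [H1 HM HV] := H_subgroup.
pose A := (expG L \o @r2v R g) @^-1` H.
have AE X : A (v2r X) <-> hset L H X.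
  rewrite /A /= v2rK; split=> [HX|[h Hh <-]]; last by rewrite logGK.
  by exists (expG L X) => //; rewrite expGK.
have A0 : A 0 by rewrite /A /= linear0.
have AB x y : A x -> A y -> A (x - y).
  rewrite /A /= linearB /= => Hx Hy.
  by have := HM _ _ Hx (HV _ Hy); rewrite /lop /linv !expGK.
have Acl : closed A.
  by apply: preimage_closed => // x _; exact: (expG_smooth L).1.
have Aco : connected A.
  have -> : A = (@v2r R g \o logG L) @` H.
    apply/seteqP; split=> [x Ax|_ [h Hh <-]].
      by exists (expG L (r2v x)) => //=; rewrite expGK r2vK.
    by rewrite /A /= v2rK logGK.
  apply: connected_continuous_connected => //.
  apply: continuous_subspaceT; exact: (logG_smooth L).1.
have AZ := closed_connected_subgroup_scale A0 AB Acl Aco.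
apply: linear_set_vspace => [|a X Y /AE AX /AE AY].
  by apply/AE; rewrite linear0.
(* The sum is written with differences because [AB] gives stability under subtraction. *)
apply/AE; have -> : v2r (a *: X + Y) = a *: v2r X - (0 - v2r Y).
  by rewrite linearP sub0r opprK.
by apply: (AB); [exact: AZ|exact: AB].
Qed.
End LogEuclideanSubspace.

(** * Isometric sections of the quotient map *)

Section Sections.
Context {R : realType} {n k : nat} {G : topologicalType} {MG : manifold R n G}
  {g : vectType R}.
Variables (L : log_euclidean MG g) (ip : {dot g for idfun}) (H : set G).
Hypothesis H_subgroup : subgroup L H.
Variables (V : {vspace g}) (P : 'End(g)).
Hypothesis VE : forall X, X \in V <-> hset L H X.
Hypothesis PV : forall X, P X \in V.
Hypothesis PP : forall X Y, Y \in V -> ip (X - P X) Y = 0.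

Lemma proj_id X : X \in V -> P X = X.
Proof.
move=> XV; apply/esym/subr0_eq/(ip_eq0 (ip := ip))/PP.
by rewrite memvB.
Qed.

Lemma proj0P X : (forall Y, Y \in V -> ip X Y = 0) <-> P X = 0.
Proof.
split=> [XV|PX Y YV]; last by rewrite -(PP X YV) PX subr0.
apply/(ip_eq0 (ip := ip)); have := PP X (PV X).
by rewrite linearBl /= XV// sub0r => /eqP; rewrite oppr_eq0 => /eqP.
Qed.

(** The coset of [X] meets h^perp only in [X - P X]: two points of h^perp in one coset differ by a
    vector of h orthogonal to itself. This injectivity makes the partial inverse return that
    point. *)
Lemma s_linE X : s_lin L H ip (lcoset L H X) = X - P X.
Proof.
have lcosetE : lcoset L H X = lcoset L H (X - P X).
  apply/seteqP; split=> _ [Y /VE YV <-].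
    by exists (P X + Y); [apply/VE; rewrite memvD|rewrite addrA subrK].
  exists (Y - P X); first by apply/VE; rewrite memvB.
  by rewrite addrCA addrC.
have inj : {in Defs.mset L H ip &, injective (lcoset L H)}.
  move=> Y Z /set_mem Ym /set_mem Zm e.
  have : lcoset L H Z Y.
    by rewrite -e; exists 0; [apply/VE; rewrite mem0v|rewrite addr0].
  move=> [W Wh YE]; rewrite -YE.
  suff -> : W = 0 by rewrite addr0.
  apply: (ip_eq0 (ip := ip)); have := Ym _ Wh.
  by rewrite -YE linearDl /= Zm// add0r.
rewrite lcosetE /s_lin pinvKV//; apply/mem_set => Y /VE YV; exact: PP.
Qed.

Lemma logG_section_s p :
  logG L (section_s ip (piG L H p)) = logG L p - P (logG L p).
Proof. by rewrite section_sE expGK s_linE. Qed.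

(** The two projections are conjugated by the coordinates of [g] so that the chain rule applies to
    them as linear maps of R^(dim g). *)
Definition lin_proj : {linear 'rV[R]_(dim g) -> 'rV[R]_(dim g)} :=
  @v2r R g \o P \o @r2v R g.
Definition lin_coproj : {linear 'rV[R]_(dim g) -> 'rV[R]_(dim g)} :=
  @v2r R g \o (\1 - P)%VF \o @r2v R g.

Variables (MQ : manifold R k (quotG L H)) (gQ : tensor_field R k (quotG L H))
  (sigma : quotG L H -> G).
Hypothesis pi_submersion :
  riemannian_submersion MG MQ (log_euclidean_metric L ip) gQ (piG L H).
Hypothesis sigma_smooth : smooth MQ MG sigma.
Hypothesis sigma_section : forall c, piG L H (sigma c) = c.

Local Notation rV := (@rV_manifold R (dim g)).
Local Notation lg := (@v2r R g \o logG L).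
Local Notation ex := (expG L \o @r2v R g).
Local Notation pi := (piG L H).

Lemma mdiff_pi p : mdiff MG MQ pi p.
Proof. exact: smooth_mdiff pi_submersion.1.1. Qed.

Lemma mdiff_sigma c : mdiff MQ MG sigma c.
Proof. exact: smooth_mdiff. Qed.

Lemma mdiff_lg p : mdiff MG rV lg p.
Proof. exact/smooth_mdiff/logG_smooth. Qed.

Lemma mdiff_ex x : mdiff rV MG ex x.
Proof. exact/smooth_mdiff/expG_smooth. Qed.

Lemma dmap_lg_sigma c : mdiff MQ rV (lg \o sigma) c /\
  dmap MQ rV (lg \o sigma) c = dmap MG rV lg (sigma c) \o dmap MQ MG sigma c.
Proof. exact: mdiff_comp_dmap (mdiff_sigma c) (mdiff_lg _). Qed.

Lemma dmap_pi_sigma c v : dmap MG MQ pi (sigma c) (dmap MQ MG sigma c v) = v.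
Proof.
have [_] := mdiff_comp_dmap (mdiff_sigma c) (mdiff_pi (sigma c)).
have -> : pi \o sigma = id by apply/funext.
by rewrite dmap_id => /(congr1 (@^~ v)) /= <-.
Qed.

Lemma log_sigma_pi p : logG L (sigma (pi p)) - P (logG L (sigma (pi p))) =
  logG L p - P (logG L p).
Proof.
have /(piG_logP H_subgroup)/VE/proj_id : pi (sigma (pi p)) = pi p by [].
rewrite linearB /= => e; apply/subr0_eq.
by rewrite opprD addrACA -opprD e subrr.
Qed.

Lemma coprojE X : (\1 - P)%VF X = X - P X.
Proof. by rewrite !lfun_simp. Qed.

Lemma mdiff_log_sigma_pi p : mdiff MG rV (lg \o sigma \o pi) p.
Proof.
have [dls _] := dmap_lg_sigma (pi p).
by have [] := mdiff_comp_dmap (mdiff_pi p) dls.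
Qed.

Lemma dmap_log_sigma_pi p v : dmap MG rV (lg \o sigma \o pi) p v =
  dmap MG rV lg (sigma (pi p)) (dmap MQ MG sigma (pi p) (dmap MG MQ pi p v)).
Proof.
have [dls dlsE] := dmap_lg_sigma (pi p).
by have [_ ->] := mdiff_comp_dmap (mdiff_pi p) dls; rewrite dlsE.
Qed.

(** This is [log_sigma_pi] differentiated at [p]. *)
Lemma dlog_sigma_pi p v :
  let w := dlog L (sigma (pi p))
    (dmap MQ MG sigma (pi p) (dmap MG MQ pi p v)) in
  w - P w = dlog L p v - P (dlog L p v).
Proof.
have e : lin_coproj \o (lg \o sigma \o pi) = lin_coproj \o lg.
  by apply/funext => q; rewrite /= !v2rK !coprojE log_sigma_pi.
have := congr1 (fun f => dmap MG rV f p v) e.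
rewrite (dmap_lin lin_coproj (mdiff_lg p)).
rewrite (dmap_lin lin_coproj (mdiff_log_sigma_pi p)) /= dmap_log_sigma_pi.
by move=> /(can_inj v2rK); rewrite !coprojE.
Qed.

(** The smooth structure of the quotient is not explicit, so the vertical space is reached through
    [sigma]: if d pi kills [w], then so does d(sigma o pi), and [dlog_sigma_pi] leaves [dlog L p w]
    no h^perp-component. *)
Lemma dlog_kernel p w : dmap MG MQ pi p w = 0 -> dlog L p w \in V.
Proof.
move=> w0; have := dlog_sigma_pi p w; cbv zeta.
rewrite w0 (_ : dlog _ _ _ = 0); last by rewrite /dlog /dmap !linear0.
by rewrite linear0 subrr => /esym/subr0_eq ->; exact: PV.
Qed.

Lemma horizontal_dlog p v : P (dlog L p v) = 0 ->
  horizontal MG MQ (log_euclidean_metric L ip) pi p v.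
Proof. by move=> /proj0P pv w /dlog_kernel; exact: pv. Qed.

Lemma dlog_ex x w : dlog L (ex x) (dmap rV MG ex x w) = r2v w.
Proof.
have [_] := mdiff_comp_dmap (mdiff_ex x) (mdiff_lg (ex x)).
have -> : lg \o ex = id by apply/funext => y /=; rewrite expGK r2vK.
by rewrite dmap_id => /(congr1 (@^~ w)) /= e; rewrite /dlog -e.
Qed.

Lemma isometry_of_translation h0 : H h0 ->
  (forall p, sigma (pi p) = lop L (section_s ip (pi p)) h0) ->
  isometric_embedding MQ MG gQ (log_euclidean_metric L ip) sigma.
Proof.
move=> Hh0 sE.
have h0V : logG L h0 \in V by apply/VE; exists h0.
have Plog c : P (logG L (sigma c)) = logG L h0.
  rewrite -{1}(sigma_section c) sE expGK logG_section_s !linearD /= linearN /=.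
  by rewrite (proj_id (PV _)) subrr add0r proj_id.
have horiz c v : horizontal MG MQ (log_euclidean_metric L ip) pi (sigma c)
    (dmap MQ MG sigma c v).
  apply: horizontal_dlog; have [dls dlsE] := dmap_lg_sigma c.
  (* The h-component of log o sigma is constant; differentiating shows that d sigma has horizontal
     values. *)
  have e : lin_proj \o (lg \o sigma) = cst (v2r (logG L h0)).
    by apply/funext => d; rewrite /= !v2rK Plog.
  have := congr1 (fun f => dmap MQ rV f c v) e.
  rewrite (dmap_lin lin_proj dls) dmap_cst dlsE /= => /(congr1 (@r2v R g)).
  by rewrite v2rK linear0.
split; last first.
  apply/funext => c; apply/funext => v; apply/funext => w; rewrite /pullback.
  by rewrite -(pi_submersion.2 _ _ _ (horiz c v) (horiz c w)) !dmap_pi_sigma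
    sigma_section.
split=> //.
- by move=> c; exact: can_inj (dmap_pi_sigma c).
- exact: can_inj sigma_section.
- move=> U; split=> [Uo|[W Wo ->]]; last first.
    by apply: open_comp => // c _; exact: sigma_smooth.1.
  (* Since pi o sigma = id, the preimage under [sigma] of this open set is [U]. *)
  exists (pi @^-1` U).
    by apply: open_comp => // p _; exact: pi_submersion.1.1.1.
  by apply/seteqP; split=> c /=; rewrite sigma_section.
Qed.

(** Let a be the log-differential of [v] and b that of its image under d(sigma o pi). Then b = a + P
    b with a orthogonal to P b, while isometry forces ip b b = ip a a; hence P b = 0. *)
Lemma dproj_sigma_pi p v :
  pullback MQ MG sigma (log_euclidean_metric L ip) = gQ ->
  P (dlog L p v) = 0 ->
  P (r2v (dmap MG rV (lg \o sigma \o pi) p v)) = 0.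
Proof.
move=> isom Pv.
have hv := horizontal_dlog Pv.
have := pi_submersion.2 _ _ _ hv hv.
rewrite -isom /pullback /log_euclidean_metric dmap_log_sigma_pi -/(dlog L _ _).
have := dlog_sigma_pi p v; cbv zeta.
move: Pv; set b := dlog L (sigma _) _; move: (dlog L p v) b => a b Pv bE.
have {}bE : b = a + P b by rewrite -[a]subr0 -Pv -bE subrK.
have aP : ip a (P b) = 0 by move/proj0P: Pv; apply.
have Pa : ip (P b) a = 0 by rewrite hermC /= aP mulr0.
rewrite {1 2}bE !linearDl !linearDr /= aP Pa addr0 add0r => /eqP.
by rewrite -subr_eq0 addrAC subrr add0r => /eqP/(ip_eq0 (ip := ip)).
Qed.

Lemma translation_of_isometry :
  pullback MQ MG sigma (log_euclidean_metric L ip) = gQ ->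
  exists2 h0, H h0 & forall p, sigma (pi p) = lop L (section_s ip (pi p)) h0.
Proof.
move=> isom.
pose phi := lg \o sigma \o pi \o ex.
(* So only the differential of phi along h^perp matters. *)
have phi_coproj : phi = phi \o lin_coproj.
  apply/funext => x; rewrite /phi /=; congr (v2r (logG L (sigma _))).
  apply/(piG_logP H_subgroup)/VE; rewrite !expGK v2rK coprojE.
  by rewrite opprB addrCA subrr addr0.
have dphi x : mdiff rV rV phi x /\
    dmap rV rV phi x = dmap MG rV (lg \o sigma \o pi) (ex x) \o dmap rV MG ex x.
  exact: mdiff_comp_dmap (mdiff_ex x) (mdiff_log_sigma_pi _).
have dF x v : mdiff rV rV (lin_proj \o phi) x /\
    dmap rV rV (lin_proj \o phi) x v = 0.
  have [dp dpE] := dphi x.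
  have [dT _] := linear_mdiff_dmap lin_proj (phi x).
  split; first by have [] := mdiff_comp_dmap dp dT.
  rewrite (dmap_lin lin_proj dp) /=.
  have [dC dCE] := linear_mdiff_dmap lin_coproj x.
  have [dpC dpCE] := dphi (lin_coproj x).
  (* The chain rule replaces [v] by its h^perp-component, whose image under d exp is horizontal, so
     [dproj_sigma_pi] applies. *)
  have [_] := mdiff_comp_dmap dC dpC; rewrite -phi_coproj => ->.
  rewrite dpCE dCE; rewrite [X in v2r X]dproj_sigma_pi ?linear0//.
  by rewrite dlog_ex /= v2rK coprojE linearB /= (proj_id (PV _)) subrr.
have Fcst := @diff0_cst R _ _ (lin_proj \o phi)
  (fun x => (dF x 0).1.2) (fun x v => (dF x v).2).
(* The constant h-component is read off at the origin; it lies in [V], the logarithm of [H]. *)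
pose h0 := expG L (r2v ((lin_proj \o phi) 0)).
have /VE[h Hh hE] : logG L h0 \in V by rewrite /h0 expGK /= v2rK.
have hh0 : h = h0 by rewrite -[h](logGK L) hE logGK.
exists h0 => [|p]; first by rewrite -hh0.
rewrite -[LHS](logGK L) /lop; congr (expG L _).
rewrite logG_section_s -log_sigma_pi /h0 expGK (Fcst 0 (lg p)) /phi /= !v2rK.
by rewrite logGK subrK.
Qed.
End Sections.

Theorem proposition4p14 (R : realType) (n k : nat)
    (G : topologicalType) (MG : manifold R n G)
    (g : vectType R) (L : log_euclidean MG g) (ip : {dot g for idfun})
    (H : set G) (H_subgroup : subgroup L H)
    (H_closed : closed H) (H_connected : connected H)
    (MQ : manifold R k (quotG L H)) (gQ : tensor_field R k (quotG L H))
    (gQ_metric : riemannian_metric MQ gQ)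
    (pi_submersion :
       riemannian_submersion MG MQ (log_euclidean_metric L ip) gQ (piG L H))
    (sigma : quotG L H -> G) (sigma_smooth : smooth MQ MG sigma)
    (sigma_section : forall c, piG L H (sigma c) = c) :
  isometric_embedding MQ MG gQ (log_euclidean_metric L ip) sigma <->
  exists2 h0 : G, H h0 &
    forall p : G, sigma (piG L H p) = lop L (section_s ip (piG L H p)) h0.
Proof.
have [V VE] := hset_linear H_subgroup H_closed H_connected.
have [P [PV PP]] := orthogonal_projection ip V.
split=> [[_ isom]|[h0 Hh0 sE]].
  exact: (translation_of_isometry H_subgroup VE PV PP pi_submersion).
exact: (isometry_of_translation H_subgroup VE PV PP pi_submersion _ _ Hh0).
Qed.
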